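(* Let $\Sigma=\{t=0\}$ in $2+1$ dimensional Minkowski space-time $\mathbb{R}^{2,1}$, and let $\mathcal{H}$ be the set of future Cauchy horizons $H^+(K)$ where $K$ ranges over compact convex subsets of $\Sigma$ with nonempty interior, with the topology on $\mathcal{H}$ induced by the Hausdorff distance between the corresponding sets $K$. Then the subset of densely nondifferentiable horizons is dense in $\mathcal{H}$: for every compact convex $K\subset\Sigma$ with nonempty interior and every $\varepsilon>0$ there exists a compact convex $K'\subset\Sigma$ with Hausdorff distance $d_H(K,K')<\varepsilon$ such that the set of points at which $H^+(K')$ fails to be differentiable is dense in $H^+(K')$. *)

(* Defs.v *)
From HB Require Import structures.
From mathcomp Require Import all_boot all_order all_algebra.
From mathcomp Require Import all_classical all_reals all_analysis.
Set Implicit Arguments. Unset Strict Implicit. Unset Printing Implicit Defensive.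
Import Order.TTheory GRing.Theory Num.Theory.
Import numFieldNormedType.Exports.
Local Open Scope classical_set_scope.
Local Open Scope ring_scope.

(* Minkowski space R^{2,1}: points are pairs (x, t) with x : 'rV[R]_2 the
   spatial position and t : R the time coordinate.  Sigma = {t = 0} is
   identified with 'rV[R]_2. *)
Definition spacetime (R : realType) := ('rV[R]_2 * R)%type.

Definition enorm (R : realType) (v : 'rV[R]_2) : R :=
  Num.sqrt (v ord0 ord0 ^+ 2 + v ord0 (lift ord0 ord0) ^+ 2).
Definition edist (R : realType) (a b : 'rV[R]_2) : R := enorm (a - b).

Definition causal_le (R : realType) (q p : spacetime R) : Prop :=
  edist p.1 q.1 <= p.2 - q.2.
Definition chrono_lt (R : realType) (q p : spacetime R) : Prop :=
  edist p.1 q.1 < p.2 - q.2.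

Definition Ipast (R : realType) (A : set (spacetime R)) : set (spacetime R) :=
  [set q | exists2 p, A p & chrono_lt q p].

(* Future domain of dependence of K subset of Sigma: the points p with t >= 0
   all of whose causal past meets Sigma inside K (in Minkowski space this is
   equivalent to: every past-inextendible causal curve through p meets K). *)
Definition Dplus (R : realType) (K : set 'rV[R]_2) : set (spacetime R) :=
  [set p | 0 <= p.2 /\ forall x : 'rV[R]_2, causal_le (x, 0) p -> K x].

Definition Hplus (R : realType) (K : set 'rV[R]_2) : set (spacetime R) :=
  closure (Dplus K) `\` Ipast (Dplus K).

Definition diff_point (R : realType) (S : set (spacetime R)) (p : spacetime R)
  : Prop :=
  exists2 W : set (spacetime R), nbhs p W &
  exists2 f : 'rV[R]_2 -> R^o, differentiable f p.1 &
    forall q, W q -> (S q <-> q.2 = f q.1).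

Definition nondiff_set (R : realType) (K : set 'rV[R]_2) : set (spacetime R) :=
  [set p | Hplus K p /\ ~ diff_point (Hplus K) p].

Definition hausdorff_dist (R : realType) (A B : set 'rV[R]_2) : R :=
  Num.max (sup [set inf [set edist a b | b in B] | a in A])
          (sup [set inf [set edist a b | a in A] | b in B]).

Definition convex_body (R : realType) (K : set 'rV[R]_2) : Prop :=
  [/\ compact K, convex_set (K : set (convex_lmodType 'rV[R]_2)) & K° !=set0].

(* Main.v *)
Require Import Defs.
From HB Require Import structures.
From mathcomp Require Import all_boot all_order all_algebra.
From mathcomp Require Import all_classical all_reals all_analysis.
From mathcomp Require Import ring lra.
Import Order.TTheory GRing.Theory Num.Theory.
Import numFieldNormedType.Exports.
Local Open Scope classical_set_scope.
Local Open Scope ring_scope.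

(* For a convex function [F], the horizon of the sublevel set [F <= c] is the
   graph of the distance [depth] to the set [F >= c].  We approximate [K] by
   the sublevel set of [F = dist(-, K) + d * (kink x1 + kink x2)], where [kink]
   is convex on the line with a corner at every rational.  At a point of the
   curve [F = c] with a rational i-th coordinate the corner of [F] prevents
   inner discs from touching, unless they touch in direction [+- e_i].

   Suppose the horizon is differentiable over a small box.  The convex
   function [(|x|^2 - depth(x)^2) / 2] has the nearest point [foot x] as a
   subgradient, hence as its gradient.  On a segment parallel to [e_i] the
   i-th coordinate of the gradient has the intermediate value property; if it
   were not constant it would take two rational values on the same side of
   the start of the segment; both foot points would then lie on the line
   carrying the segment, which is impossible since [F] is convex and [F < c]
   on the box.  So [foot] is constant on the box, contradicting the convexity
   of [F <= c]. *)

Set Implicit Arguments.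
Unset Strict Implicit.

(* all_analysis also exports an [edist]. *)
Local Notation edist := Defs.edist.

(** * The Euclidean plane *)

Section Plane.
Context {R : realType}.
Implicit Types (x y z u v p : 'rV[R]_2) (i j k : 'I_2).

Lemma ord2_cases i j k : i != j -> k = i \/ k = j.
Proof.
move=> ij; have [->|ki] := eqVneq k i; first by left.
right; apply/val_inj; move: ij ki; rewrite -!val_eqE /=.
by case: i j k => [[|[|]]//= _] [[|[|]]//= _] [[|[|]]//= _].
Qed.

Lemma ord2_other i : exists j, i != j.
Proof. by exists (rev_ord i); case: i => [[|[|]]]. Qed.

Lemma row2_eq i j x y : i != j ->
  x ord0 i = y ord0 i -> x ord0 j = y ord0 j -> x = y.
Proof.
by move=> ij xi xj; apply/rowP => k; have [->|->] := ord2_cases k ij.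
Qed.

Lemma enorm_ge0 v : 0 <= enorm v. Proof. exact: sqrtr_ge0. Qed.

Lemma enorm_sqr i j v : i != j ->
  enorm v ^+ 2 = v ord0 i ^+ 2 + v ord0 j ^+ 2.
Proof.
move=> ij; rewrite /enorm sqr_sqrtr ?addr_ge0 ?sqr_ge0//.
have h01 : (ord0 : 'I_2) != lift ord0 ord0 by [].
case: (ord2_cases i h01) (ord2_cases j h01) ij => -> [] -> //= _.
by rewrite addrC.
Qed.

Lemma enorm_sqr01 v :
  enorm v ^+ 2 = v ord0 ord0 ^+ 2 + v ord0 (lift ord0 ord0) ^+ 2.
Proof. exact: enorm_sqr. Qed.

Lemma enorm_le v r : 0 <= r -> (enorm v <= r) = (enorm v ^+ 2 <= r ^+ 2).
Proof. by move=> r0; rewrite ler_sqr ?nnegrE ?enorm_ge0. Qed.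

Lemma enormD u v : enorm (u + v) <= enorm u + enorm v.
Proof.
rewrite enorm_le ?addr_ge0 ?enorm_ge0// sqrrD !enorm_sqr01 !mxE.
set a := u _ _; set b := u _ _; set c := v _ _; set d := v _ _.
suff : a * c + b * d <= enorm u * enorm v by nra.
apply: le_trans (ler_norm _) _.
rewrite -ler_sqr ?nnegrE ?mulr_ge0 ?enorm_ge0// exprMn !enorm_sqr01.
rewrite real_normK ?num_real// -/a -/b -/c -/d.
have := sqr_ge0 (a * d - b * c); nra.
Qed.

Lemma enormZ a v : enorm (a *: v) = `|a| * enorm v.
Proof.
apply/eqP; rewrite -(@eqrXn2 _ 2) ?mulr_ge0 ?enorm_ge0// exprMn !enorm_sqr01.
by rewrite !mxE real_normK ?num_real//; apply/eqP; ring.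
Qed.

Lemma enormN v : enorm (- v) = enorm v.
Proof. by rewrite -scaleN1r enormZ normrN1 mul1r. Qed.

Lemma enorm_eq0 v : enorm v = 0 -> v = 0.
Proof.
move=> v0; have := enorm_sqr01 v; rewrite v0 expr0n /= => /esym/eqP.
rewrite paddr_eq0 ?sqr_ge0// !sqrf_eq0 => /andP[/eqP a /eqP b].
by apply: (@row2_eq ord0 (lift ord0 ord0)); rewrite // mxE.
Qed.

Lemma coord_le_enorm i v : `|v ord0 i| <= enorm v.
Proof.
have [j ij] := ord2_other i.
rewrite -ler_sqr ?nnegrE ?enorm_ge0// real_normK ?num_real//.
by rewrite (enorm_sqr _ ij) lerDl sqr_ge0.
Qed.

Lemma enorm_le_norm v : enorm v <= 2 * `|v|.
Proof.
have h k : `|v ord0 k| <= `|v|.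
  rewrite [leRHS]mx_normrE.
  exact: (le_bigmax _ (fun ij : 'I_1 * 'I_2 => `|v ij.1 ij.2|) (ord0, k)).
rewrite enorm_le ?mulr_ge0// enorm_sqr01.
rewrite -!(real_normK (num_real (v _ _))).
have := h ord0; have := h (lift ord0 ord0).
have := normr_ge0 (v ord0 ord0); have := normr_ge0 (v ord0 (lift ord0 ord0)).
nra.
Qed.

Lemma norm_le_enorm v : `|v| <= enorm v.
Proof.
rewrite [leLHS]mx_normrE; apply: bigmax_le; rewrite ?enorm_ge0// => -[a k] _ /=.
by rewrite (ord1 a) coord_le_enorm.
Qed.

Lemma edist_ge0 x y : 0 <= edist x y. Proof. exact: enorm_ge0. Qed.

Lemma edistC x y : edist x y = edist y x.
Proof. by rewrite /edist -enormN opprB. Qed.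

Lemma edistxx x : edist x x = 0.
Proof. by rewrite /edist subrr -[0](scale0r 0) enormZ normr0 mul0r. Qed.

Lemma edist_triangle y x z : edist x z <= edist x y + edist y z.
Proof. by rewrite /edist -(subrKA y) enormD. Qed.

Lemma edist_eq0 x y : edist x y = 0 -> x = y.
Proof. by move=> /enorm_eq0/eqP; rewrite subr_eq0 => /eqP. Qed.

Lemma edist_sqr i j x y : i != j ->
  edist x y ^+ 2 = (x ord0 i - y ord0 i) ^+ 2 + (x ord0 j - y ord0 j) ^+ 2.
Proof. by move=> ij; rewrite (enorm_sqr _ ij) !mxE. Qed.

Lemma edist_lipschitz x y z : edist x z <= edist y z + 1 * edist x y.
Proof. by rewrite mul1r addrC edist_triangle. Qed.

Lemma lipschitz_continuous (f : 'rV[R]_2 -> R) L :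
  (forall x y, f x <= f y + L * edist x y) -> continuous f.
Proof.
move=> fL x; apply/(@cvgrPdist_lt _ _ _ (nbhs x)) => e e0.
(* The topology is that of the max norm, and [edist] is at most twice its distance; [L] has no
   prescribed sign. *)
have M0 : 0 < 2 * `|L| + 1 by rewrite ltr_wpDl ?mulr_ge0.
apply/nbhs_ballP; exists (e / (2 * `|L| + 1)) => [|y] /=; first exact: divr_gt0.
rewrite mx_norm_ball /= => xy.
have xye : `|x - y| * (2 * `|L| + 1) < e by rewrite -ltr_pdivlMr.
have h a b : f a - f b <= `|L| * edist a b.
  rewrite lerBlDl (le_trans (fL a b))// lerD2l ler_wpM2r ?edist_ge0//.
  exact: ler_norm.
have LM : `|L| * edist x y <= `|x - y| * (2 * `|L|).
  have := enorm_le_norm (x - y); rewrite /edist; have := normr_ge0 L; nra.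
have h1 := h x y; have h2 := h y x; rewrite (edistC y x) in h2.
have := normr_ge0 (x - y) => n0.
rewrite ltr_norml; apply/andP; split; nra.
Qed.

End Plane.

(** * A convex function with corners at the rationals *)

Section Kink.
Context {R : realType}.
Implicit Types (s t l : R) (n m k : nat).

Definition kink_node n : R := if unpickle n is Some q then ratr (q : rat) else 0.

(** As |t - q| <= (1 + |q|)(1 + |t|), the denominator bounds the n-th term of the series at t by
    2^-n (1 + |t|). *)
Definition kink_weight n : R := 2^-1 ^+ n / (1 + `|kink_node n|).

Definition kink_sum n t : R := \sum_(k < n) kink_weight k * `|t - kink_node k|.

(* The series of weighted distances to an enumeration of the rationals; the
   weights make it converge, and it has a corner at every rational. *)
Definition kink t : R := sup (range (kink_sum^~ t)).

Lemma kink_weight_gt0 n : 0 < kink_weight n.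
Proof. by rewrite divr_gt0 ?exprn_gt0 ?invr_gt0// ltr_pwDl. Qed.

Lemma kink_weightE n : kink_weight n * (1 + `|kink_node n|) = 2^-1 ^+ n.
Proof. by rewrite divfK// gt_eqF// ltr_pwDl. Qed.

Lemma sum_half n : \sum_(k < n) (2^-1 : R) ^+ k <= 2.
Proof.
suff -> : \sum_(k < n) (2^-1 : R) ^+ k = 2 - 2 * 2^-1 ^+ n.
  by rewrite gerBl mulr_ge0// exprn_ge0// invr_ge0.
elim: n => [|n IH]; first by rewrite big_ord0 expr0; ring.
by rewrite big_ord_recr /= IH exprS; field.
Qed.

Lemma kink_sum_lipschitz n s t : kink_sum n s <= kink_sum n t + 2 * `|s - t|.
Proof.
apply: (@le_trans _ _ (\sum_(k < n) (kink_weight k * `|t - kink_node k| +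
    2^-1 ^+ k * `|s - t|))).
  apply: ler_sum => k _; rewrite -kink_weightE.
  have := ler_distD t s (kink_node k); have := kink_weight_gt0 k.
  have := normr_ge0 (s - t); have := normr_ge0 (kink_node k).
  move=> q0 st0 w0 h; have := mulr_ge0 (ltW w0) (mulr_ge0 q0 st0).
  have := ler_wpM2l (ltW w0) h; nra.
by rewrite big_split /= lerD2l -mulr_suml ler_wpM2r// sum_half.
Qed.

Lemma kink_sum_bound n t : kink_sum n t <= 2 * (1 + `|t|).
Proof.
apply: (@le_trans _ _ (\sum_(k < n) 2^-1 ^+ k * (1 + `|t|))).
  apply: ler_sum => k _; rewrite -kink_weightE.
  have w0 := kink_weight_gt0 k; rewrite -[leRHS]mulrA ler_pM2l//.
  have := ler_normB t (kink_node k).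
  have := normr_ge0 t; have := normr_ge0 (kink_node k); nra.
by rewrite -mulr_suml ler_wpM2r ?sum_half// addr_ge0.
Qed.

Lemma kink_sum_homo n m t : (n <= m)%N -> kink_sum n t <= kink_sum m t.
Proof.
move=> nm; rewrite -(subnKC nm); elim: (m - n)%N => [|k IH]; first by rewrite addn0.
rewrite addnS (le_trans IH)// /kink_sum big_ord_recr /= lerDl.
by rewrite mulr_ge0// ltW// kink_weight_gt0.
Qed.

Lemma kink_sum_le n t : kink_sum n t <= kink t.
Proof.
apply: ub_le_sup; last by exists n.
by exists (2 * (1 + `|t|)) => _ [k _ <-]; exact: kink_sum_bound.
Qed.

Lemma kink_le t B : (forall n, kink_sum n t <= B) -> kink t <= B.
Proof.
move=> h; apply: ge_sup; first by exists (kink_sum 0 t), 0%N.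
by move=> _ [n _ <-].
Qed.

Lemma kink_ge0 t : 0 <= kink t.
Proof. by rewrite (le_trans _ (kink_sum_le 0 t))// /kink_sum big_ord0. Qed.

Lemma kink_bound t : kink t <= 2 * (1 + `|t|).
Proof. by apply: kink_le => n; exact: kink_sum_bound. Qed.

Lemma kink_lipschitz s t : kink s <= kink t + 2 * `|s - t|.
Proof.
apply: kink_le => n; apply: (le_trans (kink_sum_lipschitz n s t)).
by rewrite lerD2r kink_sum_le.
Qed.

Lemma kink_convex l s t : 0 <= l -> l <= 1 ->
  kink (l * s + (1 - l) * t) <= l * kink s + (1 - l) * kink t.
Proof.
move=> l0 l1; apply: kink_le => n.
apply: (@le_trans _ _ (l * kink_sum n s + (1 - l) * kink_sum n t)); last first.
  by rewrite lerD// ler_wpM2l ?subr_ge0// kink_sum_le.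
rewrite !mulr_sumr -big_split; apply: ler_sum => k _ /=.
rewrite mulrCA [X in _ <= _ + X]mulrCA -mulrDr ler_wpM2l ?(ltW (kink_weight_gt0 k))//.
rewrite -[X in X * `|s - _|]ger0_norm// -[X in X * `|t - _|]ger0_norm ?subr_ge0//.
rewrite -!normrM; apply: le_trans (ler_normD _ _); rewrite le_eqVlt; apply/orP; left.
by apply/eqP; congr `|_|; ring.
Qed.

(** The term with node [q] contributes exactly 2a|t| to the second difference; the other terms are
    convex and contribute nonnegatively. *)
Lemma kink_corner (q : rat) : exists2 a : R, 0 < a &
  forall t, 2 * kink (ratr q) + 2 * a * `|t| <=
            kink (ratr q + t) + kink (ratr q - t).
Proof.
set k := pickle q.
have kE : kink_node k = ratr q by rewrite /kink_node pickleK.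
exists (kink_weight k) => [|t]; first exact: kink_weight_gt0.
have h n : (k < n)%N -> 2 * kink_sum n (ratr q) + 2 * kink_weight k * `|t| <=
    kink (ratr q + t) + kink (ratr q - t).
  move=> kn; apply: le_trans (lerD (kink_sum_le n _) (kink_sum_le n _)).
  rewrite /kink_sum mulr_sumr -big_split /= (bigD1 (Ordinal kn))//=.
  rewrite [leRHS](bigD1 (Ordinal kn))//= kE subrr normr0 mulr0 mulr0 add0r addrC.
  apply: lerD; last first.
    have -> : ratr q + t - ratr q = t by ring.
    have -> : ratr q - t - ratr q = - t by ring.
    by rewrite normrN le_eqVlt; apply/orP; left; apply/eqP; ring.
  apply: ler_sum => i _; rewrite -mulrDr mulrCA ler_wpM2l ?(ltW (kink_weight_gt0 i))//.
  apply: le_trans (ler_normD _ _); rewrite -[X in X * _]ger0_norm// -normrM.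
  by rewrite le_eqVlt; apply/orP; left; apply/eqP; congr `|_|; ring.
suff : kink (ratr q) <= (kink (ratr q + t) + kink (ratr q - t) -
    2 * kink_weight k * `|t|) / 2 by lra.
(* Passing to [k.+1 + n] terms only increases the partial sum and ensures that the term of [q]
   occurs. *)
apply: kink_le => n; apply: le_trans (kink_sum_homo (ratr q) (leq_addl k.+1 n)) _.
have := h (k.+1 + n)%N (leq_addr _ _); lra.
Qed.

End Kink.

(** * Subgradients of differentiable functions on the line *)

Section Subgradient.
Context {R : realType}.
Implicit Types (f g : R -> R) (a b m q s t : R).

(** Subtracting a linear function of slope [m] leaves a minimum at the interior point [s], so the
    derivative there is [m]. *)
Lemma subgradient_unique f a b s m m' :
  (forall t, t \in `]a, b[ -> derivable f t 1) -> s \in `]a, b[ ->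
  (forall t, t \in `]a, b[ -> f s + m * (t - s) <= f t) ->
  (forall t, t \in `]a, b[ -> f s + m' * (t - s) <= f t) -> m = m'.
Proof.
move=> df sab hm hm'.
have ab : a <= b by move: sab; rewrite in_itv /= => /andP[/lt_trans h /h /ltW].
have key k : (forall t, t \in `]a, b[ -> f s + k * (t - s) <= f t) ->
    'D_1 f s = k.
  move=> hk; have dk t : derivable ( *%R k) t 1.
    by apply: derivableM => //; exact: derivable_id.
  have [dh h0] : is_derive s 1 (f - ( *%R k)) 0.
    apply: (derive1_at_min ab _ sab) => t tab.
      by apply: derivableB; [exact: df|exact: dk].
    by rewrite !fctE; have := hk t tab; lra.
  move: h0; rewrite deriveB; [|exact: df|exact: dk].
  have -> : 'D_1 ( *%R k) s = k.
    by rewrite deriveM// ?derive_cst ?derive_id; rewrite scaler0 addr0 [LHS]mulr1.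
  by move/eqP; rewrite subr_eq0 => /eqP.
by rewrite -(key m hm) -(key m' hm').
Qed.

(* A minimizer of [f t - q * t] on [[s, s']] is a global one, because the
   subgradients at the end points push inwards. *)
Lemma subgradient_darboux f g a b s s' q :
  (forall t, t \in `]a, b[ -> derivable f t 1) ->
  (forall t u, t \in `]a, b[ -> u \in `]a, b[ -> f t + g t * (u - t) <= f u) ->
  s \in `]a, b[ -> s' \in `]a, b[ -> s <= s' -> g s <= q -> q <= g s' ->
  exists2 t, t \in `]a, b[ & g t = q.
Proof.
move=> df hg sab s'ab ss' gs gs'.
have sub t : t \in `[s, s'] -> t \in `]a, b[.
  by apply: subset_itvSoo; move: sab s'ab;
    rewrite !in_itv /= !bnd_simp => /andP[] + _ /andP[].
have ch : {within `[s, s'], continuous (f - *%R q)}.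
  apply: derivable_within_continuous => t ts; apply: derivableB.
    exact/df/sub.
  by apply: derivableM => //; exact: derivable_id.
have [t ts ht] := EVT_min ss' ch; exists t; first exact: sub.
have h0 : f t - q * t <= f s - q * s.
  by have := ht s; rewrite !fctE; apply; rewrite in_itv /= lexx.
have h1 : f t - q * t <= f s' - q * s'.
  by have := ht s'; rewrite !fctE; apply; rewrite in_itv /= lexx andbT.
apply: (subgradient_unique df (sub _ ts)) => u uab; first exact: hg (sub _ ts) uab.
suff : f t - q * t <= f u - q * u by lra.
have [us|su] := ltP u s; first by have := hg s u sab uab; nra.
have [us'|s'u] := leP u s'; last by have := hg s' u s'ab uab; nra.
by have := ht u; rewrite !fctE; apply; rewrite in_itv /= su.
Qed.

End Subgradient.

(** * Closedness of sublevel and superlevel sets *)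

Lemma closed_sublevel {R : realType} {T : topologicalType} (f : T -> R) (a : R) :
  continuous f -> closed [set x | f x <= a].
Proof.
by move=> cf; apply: (@preimage_closed _ _ f [set x | x <= a]) (@closed_le _ a) => x _.
Qed.

Lemma closed_superlevel {R : realType} {T : topologicalType} (f : T -> R) (a : R) :
  continuous f -> closed [set x | a <= f x].
Proof.
by move=> cf; apply: (@preimage_closed _ _ f [set x | a <= x]) (@closed_ge _ a) => x _.
Qed.

(** * Horizons of convex sublevel sets *)

Section SublevelSet.
Context {R : realType} (F : 'rV[R]_2 -> R) (c L : R) (z0 y0 : 'rV[R]_2).
Context (L_ge0 : 0 <= L)
  (F_lipschitz : forall x y, F x <= F y + L * edist x y)
  (F_convex : forall l x y, 0 <= l -> l <= 1 ->
    F (l *: x + (1 - l) *: y) <= l * F x + (1 - l) * F y)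
  (F_z0 : F z0 < c) (F_y0 : c <= F y0).
Implicit Types (x y z p u v : 'rV[R]_2) (i j : 'I_2).

(** The set [c <= F] is closed, unlike the complement of the sublevel set, so that the minimum is
    attained. *)
Definition nearest x p :=
  c <= F p /\ forall y, c <= F y -> edist x p <= edist x y.

Lemma nearest_exists x : exists p, nearest x p.
Proof.
pose A := [set y | c <= F y] `&` [set y | edist y x <= edist x y0].
have ce : continuous (fun y => edist y x).
  by apply: (@lipschitz_continuous _ _ 1) => a b; exact: edist_lipschitz.
have cA : compact A.
  apply: bounded_closed_compact.
    exists (`|x| + edist x y0); split; first exact: num_real.
    move=> M hM y [_ /= hy]; rewrite (le_trans _ (ltW hM))//.
    have -> : y = x + (y - x) by rewrite addrC subrK.
    rewrite (le_trans (ler_normD _ _))// lerD2l.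
    by rewrite (le_trans (norm_le_enorm _)).
  apply: closedI; last exact: closed_sublevel.
  by apply: closed_superlevel; apply: (lipschitz_continuous F_lipschitz).
have A0 : A !=set0 by exists y0; split => //=; rewrite edistC.
have [p] := compact_EVT_min A0 cA (continuous_subspaceT ce).
rewrite inE => -[/= cp xp] hp; exists p; split => // y cy.
have [h|/ltW h] := leP (edist y x) (edist x y0); last first.
  by rewrite edistC (le_trans xp)// [leRHS]edistC.
by rewrite edistC [leRHS]edistC; apply: hp; rewrite inE.
Qed.

Definition foot x : 'rV[R]_2 := sval (cid (nearest_exists x)).

Definition depth x : R := edist x (foot x).

Lemma footP x : nearest x (foot x).
Proof. exact: (svalP (cid (nearest_exists x))). Qed.

Lemma depth_nearest x p : nearest x p -> depth x = edist x p.
Proof.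
move=> [cp hp]; have [cf hf] := footP x.
by apply/eqP; rewrite eq_le hf// hp.
Qed.

Lemma depth_ge0 x : 0 <= depth x. Proof. exact: edist_ge0. Qed.

Lemma depth_le x y : c <= F y -> depth x <= edist x y.
Proof. by have [_] := footP x; exact. Qed.

Lemma depth_lipschitz x y : depth x <= depth y + 1 * edist x y.
Proof.
have [cf _] := footP y; rewrite mul1r addrC.
exact: (le_trans (depth_le x cf) (edist_triangle y _ _)).
Qed.

(** If [F p > c], a small step from [p] towards [x] keeps [F] above [c] and comes closer to [x]. *)
Lemma nearest_level x p : F x <= c -> nearest x p -> F p = c.
Proof.
move=> xc [cp hp]; apply/eqP; rewrite eq_le cp andbT leNgt; apply/negP => pc.
(* [D] makes [e < 1] and the Lipschitz loss [e * (L * edist p x)] at most [F p - c]. *)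
pose D := L * edist p x + 1 + (F p - c); pose e := (F p - c) / D.
have D0 : 0 < D.
  have := mulr_ge0 L_ge0 (edist_ge0 p x); rewrite /D; lra.
have e0 : 0 < e by rewrite divr_gt0// subr_gt0.
have eD : e * D = F p - c by rewrite divfK ?gt_eqF.
have e1 : e < 1.
  by rewrite ltr_pdivrMr// /D; have := mulr_ge0 L_ge0 (edist_ge0 p x); lra.
have dy : edist p (p + e *: (x - p)) = e * edist p x.
  by rewrite /edist opprD addNKr -scalerN opprB enormZ gtr0_norm.
have dx : edist x (p + e *: (x - p)) = (1 - e) * edist x p.
  rewrite /edist -[X in X * enorm _]ger0_norm ?subr_ge0 ?ltW// -enormZ.
  by congr enorm; apply/rowP => k; rewrite !mxE; ring.
have cy : c <= F (p + e *: (x - p)).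
  have := F_lipschitz p (p + e *: (x - p)); rewrite dy.
  have := mulr_ge0 L_ge0 (edist_ge0 p x).
  move: eD; rewrite /D; set a := edist p x; set b := F (_ + _).
  move=> eD La; have : e * (L * a) <= F p - c by nra.
  lra.
have := hp _ cy; rewrite dx.
have := edist_ge0 x p => d0 h.
have /edist_eq0 xp : edist x p = 0 by nra.
by move: pc; rewrite -xp ltNge xc.
Qed.

(** A point of this disc with [F y > c] would be nearest to [x], hence on the level [c]. *)
Lemma depth_closed_ball x y : F x <= c -> edist x y <= depth x -> F y <= c.
Proof.
move=> xc xy; rewrite leNgt; apply/negP => yc.
suff : nearest x y by move=> /(nearest_level xc) yE; rewrite yE ltxx in yc.
split; first exact: ltW.
by move=> z cz; rewrite (le_trans xy)// depth_le.
Qed.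

(** Otherwise [p] is a proper convex combination of a point with [F <= c] and of [x], where [F < c],
    so [F p < c]. *)
Lemma level_beyond x p e : F x < c -> c <= F p -> 0 < e ->
  c < F (p + e *: (p - x)).
Proof.
move=> xc cp e0; rewrite ltNge; apply/negP => h.
have e1 : 0 < 1 + e by lra.
have l1 : (1 + e)^-1 <= 1 by rewrite invf_le1//; lra.
have le1 : (1 + e)^-1 * (1 + e) = 1 by rewrite mulVf// gt_eqF.
have l0 : 0 < (1 + e)^-1 by rewrite invr_gt0.
have := F_convex (p + e *: (p - x)) x (ltW l0) l1.
have -> : (1 + e)^-1 *: (p + e *: (p - x)) + (1 - (1 + e)^-1) *: x = p.
  by apply/rowP => k; rewrite !mxE; field; rewrite gt_eqF.
move: l0 le1; set l := _^-1 => l0 le1.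
have l1' : l < 1 by nra.
have h1 : l * F (p + e *: (p - x)) <= l * c by rewrite ler_wpM2l// ltW.
have h2 : (1 - l) * F x < (1 - l) * c by rewrite ltr_pM2l// subr_gt0.
lra.
Qed.

Lemma sublevel_toward x e : F x <= c -> 0 < e -> e <= 1 ->
  F (x + e *: (z0 - x)) < c.
Proof.
move=> xc e0 e1; have := F_convex z0 x (ltW e0) e1.
have -> : e *: z0 + (1 - e) *: x = x + e *: (z0 - x).
  by apply/rowP => k; rewrite !mxE; ring.
have h1 : e * F z0 < e * c by rewrite ltr_pM2l.
have h2 : (1 - e) * F x <= (1 - e) * c by rewrite ler_wpM2l// subr_ge0.
lra.
Qed.

(** * The horizon as the graph of [depth] *)

Local Notation K := [set x | F x <= c].

Lemma Dplus_sublevel (p : spacetime R) :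
  Dplus K p <-> F p.1 <= c /\ 0 <= p.2 <= depth p.1.
Proof.
case: p => x t; rewrite /Dplus /causal_le /=; split; last first.
  move=> [xc /andP[t0 td]]; split => // y; rewrite subr0 => xy.
  exact: (depth_closed_ball xc (le_trans xy td)).
move=> [t0 h]; have xc : F x <= c by apply: h; rewrite edistxx subr0.
split => //; rewrite t0 /= leNgt; apply/negP => dt.
have [cf _] := footP x.
have n0 := edist_ge0 (foot x) z0.
(* The disc of radius [t] about [x] reaches a point beyond the foot. The ray starts at [z0] rather
   than at [x], because [F x = c] is possible. *)
pose e := (t - depth x) / (1 + edist (foot x) z0).
have e0 : 0 < e by rewrite divr_gt0 ?subr_gt0// ltr_pwDl.
have eE : e * (1 + edist (foot x) z0) = t - depth x.
  by rewrite divfK// gt_eqF// ltr_pwDl.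
have := level_beyond F_z0 cf e0; rewrite ltNge => /negP; apply.
apply: h; rewrite subr0 (le_trans (edist_triangle (foot x) _ _))//.
rewrite -/(depth x) /edist opprD addNKr -scalerN enormZ gtr0_norm//.
rewrite -enormN opprK -/(edist (foot x) z0).
nra.
Qed.

Lemma closed_Dplus_sublevel : closed (Dplus K).
Proof.
have -> : Dplus K = [set p | F p.1 <= c] `&` ([set p | 0 <= p.2] `&`
    [set p | p.2 - depth p.1 <= 0]).
  rewrite eqEsubset; split => [p /Dplus_sublevel[? /andP[? ?]]|p [? [? ?]]].
    by repeat split => //=; rewrite subr_le0.
  by apply/Dplus_sublevel; split => //; apply/andP; split => //; rewrite -subr_le0.
have cF : continuous F := lipschitz_continuous F_lipschitz.
have cd : continuous depth := lipschitz_continuous depth_lipschitz.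
apply: closedI; [|apply: closedI].
- apply: (@closed_sublevel _ _ (F \o fst)) => p.
  by apply: continuous_comp; [exact: cvg_fst|exact: cF].
- by apply: (@closed_superlevel _ _ snd) => p; exact: cvg_snd.
- apply: (@closed_sublevel _ _ (fun p : spacetime R => p.2 - depth p.1)) => p.
  apply: (@continuousB _ _ _ snd (depth \o fst)); first exact: cvg_snd.
  by apply: continuous_comp; [exact: cvg_fst|exact: cd].
Qed.

(** Points below the graph precede the graph point vertically above them; graph points precede no
    point of [Dplus K], because [depth] is 1-Lipschitz. *)
Lemma Hplus_sublevel (p : spacetime R) :
  Hplus K p <-> F p.1 <= c /\ p.2 = depth p.1.
Proof.
rewrite /Hplus -(closure_id _).1; last exact: closed_Dplus_sublevel.
case: p => x t; split => [[/Dplus_sublevel[/= xc /andP[t0 td]] nI]|[/= xc ->]].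
  split => //=; apply/eqP; rewrite eq_le td /= leNgt; apply/negP => tlt.
  apply: nI; exists (x, depth x); last by rewrite /chrono_lt /= edistxx subr_gt0.
  by apply/Dplus_sublevel => /=; rewrite depth_ge0 lexx.
split; first by apply/Dplus_sublevel => /=; rewrite depth_ge0 lexx.
move=> [[y s] /Dplus_sublevel[/= yc /andP[_ sd]]]; rewrite /chrono_lt /=.
by have := depth_lipschitz y x; lra.
Qed.

Context (F_corner : forall (q : rat) i, exists2 a : R, 0 < a &
  forall p u, p ord0 i = ratr q ->
    2 * F p + 2 * a * `|u ord0 i| <= F (p + u) + F (p - u)).

(* The points [p - s^2 v + s w] and [p - s^2 v - s w] below, with [w]
   orthogonal to [v = p - x], lie in the disc about [x] through [p]; the corner
   of [F] at [p] would be visible at order [s] if [w] had a nonzero [i]-th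
   coordinate. *)
Lemma nearest_rational i j x p (q : rat) : i != j -> F x < c -> nearest x p ->
  p ord0 i = ratr q -> p ord0 j = x ord0 j.
Proof.
move=> ij xc np piq; have pc := nearest_level (ltW xc) np.
have [a a0 ha] := F_corner q i.
pose b := x ord0 j - p ord0 j.
pose v := p - x.
pose w : 'rV[R]_2 := \row_k (if k == i then b else v ord0 i).
have wi : w ord0 i = b by rewrite mxE eqxx.
have wj : w ord0 j = v ord0 i by rewrite mxE eq_sym (negPf ij).
have vi : v ord0 i = p ord0 i - x ord0 i by rewrite !mxE.
have vj : v ord0 j = - b by rewrite !mxE /b opprB.
have nE : enorm v ^+ 2 = b ^+ 2 + v ord0 i ^+ 2.
  by rewrite (enorm_sqr _ ij) vj; ring.
have inball s (d : R) : 0 < s -> s <= 1 -> d ^+ 2 = 1 ->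
    F (p - s ^+ 2 *: v + (d * s) *: w) <= c.
  move=> s0 s1 d1; apply: (depth_closed_ball (ltW xc)).
  rewrite (depth_nearest np) [edist x p]edistC edistC.
  rewrite /edist -/v enorm_le ?enorm_ge0// nE (enorm_sqr _ ij) !mxE.
  have wi' := wi; have wj' := wj; rewrite !mxE in wi' wj'; rewrite wi' wj'.
  have vi' := vi; rewrite !mxE in vi'.
  have -> : p ord0 i - x ord0 i = v ord0 i by rewrite vi.
  have -> : p ord0 j - x ord0 j = - b by rewrite /b opprB.
  set g := v ord0 i.
  have -> : p ord0 i + - (s ^+ 2 * g) + d * s * b - x ord0 i =
    (1 - s ^+ 2) * g + d * s * b by rewrite /g vi; ring.
  have -> : p ord0 j + - (s ^+ 2 * - b) + d * s * g - x ord0 j =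
    - ((1 - s ^+ 2) * b - d * s * g) by rewrite /b; ring.
  have -> : ((1 - s ^+ 2) * g + d * s * b) ^+ 2 +
    (- ((1 - s ^+ 2) * b - d * s * g)) ^+ 2 =
    ((1 - s ^+ 2) ^+ 2 + d ^+ 2 * s ^+ 2) * (b ^+ 2 + g ^+ 2) by ring.
  rewrite d1 mul1r ler_piMl ?addr_ge0 ?sqr_ge0//.
  have : s ^+ 2 <= 1 by rewrite expr_le1// ltW.
  have := sqr_ge0 s; nra.
(* The sum of [F] over the two disc points is at most 2c; the corner raises the sum over
   [p + s *: w] and [p - s *: w] by 2as|b|, and each displacement by [s ^+ 2 *: v] costs at most L
   s^2 |v|. *)
have key s : 0 < s -> s <= 1 -> a * `|b| <= s * (L * enorm v).
  move=> s0 s1; have h1 := inball s 1 s0 s1 (expr1n _ _).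
  have h2 := inball s (- 1) s0 s1 (etrans (sqrrN 1) (expr1n _ 2)).
  have h3 := ha p (s *: w) piq.
  have l1 := F_lipschitz (p + s *: w) (p - s ^+ 2 *: v + (1 * s) *: w).
  have l2 := F_lipschitz (p - s *: w) (p - s ^+ 2 *: v + (-1 * s) *: w).
  have e1 : edist (p + s *: w) (p - s ^+ 2 *: v + (1 * s) *: w) =
      s ^+ 2 * enorm v.
    rewrite /edist -[X in _ = X * _]ger0_norm ?sqr_ge0// -enormZ; congr enorm.
    by apply/rowP => k; rewrite !mxE; ring.
  have e2 : edist (p - s *: w) (p - s ^+ 2 *: v + (-1 * s) *: w) =
      s ^+ 2 * enorm v.
    rewrite /edist -[X in _ = X * _]ger0_norm ?sqr_ge0// -enormZ; congr enorm.
    by apply/rowP => k; rewrite !mxE; ring.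
  rewrite e1 in l1; rewrite e2 in l2; move: h3.
  rewrite [(s *: w) _ _]mxE wi normrM gtr0_norm// pc => h3.
  have : s * (a * `|b|) <= s * (s * (L * enorm v)) by nra.
  by rewrite ler_pM2l.
apply/esym/eqP; rewrite -subr_eq0 -/b -normr_eq0 eq_le normr_ge0 andbT.
rewrite leNgt; apply/negP => b0.
have ab : 0 < a * `|b| by rewrite mulr_gt0.
have M0 : 0 <= L * enorm v by rewrite mulr_ge0// enorm_ge0.
(* For s = a|b| / (2D), the right-hand side of [key] is at most half of a|b|. *)
pose D := L * enorm v + a * `|b|.
have D0 : 0 < D by rewrite ltr_wpDl.
have hD : a * `|b| / D / 2 * D = a * `|b| / 2.
  by field; rewrite gt_eqF.
have s0 : 0 < a * `|b| / D / 2 by rewrite !divr_gt0.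
have s1 : a * `|b| / D / 2 <= 1.
  have : a * `|b| / D <= 1 by rewrite ler_pdivrMr// mul1r lerDr.
  lra.
have := key _ s0 s1; move: hD s0; rewrite /D; set s := _ / 2 => hD s0.
nra.
Qed.


(** * The potential on lines parallel to the axes *)

Local Notation unit i := (delta_mx ord0 i : 'rV[R]_2).

Lemma unit_coord x i s : (x + s *: unit i) ord0 i = x ord0 i + s.
Proof. by rewrite !mxE !eqxx mulr1. Qed.

Lemma unit_coord_neq x i j s : i != j -> (x + s *: unit i) ord0 j = x ord0 j.
Proof. by move=> ij; rewrite !mxE eq_sym (negPf ij) andbF mulr0 addr0. Qed.

Lemma ball_coordP x y (r : R) : 0 < r ->
  ball x r y <-> forall k, `|x ord0 k - y ord0 k| < r.
Proof.
move=> r0; split => [[_ h] k|h]; first exact: (h ord0 k).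
by split => // a k; rewrite (ord1 a); exact: h.
Qed.

(* Half the squared norm minus half the squared depth is the convex function
   [x |-> sup_p (<p, x> - |p|^2 / 2)], [p] ranging over [F p >= c], and
   the nearest points are its subgradients. *)
Definition potential x : R := (enorm x ^+ 2 - depth x ^+ 2) / 2.

(** Replacing [depth] by the distance to [p] turns the potential into an affine function of [t] with
    slope [p ord0 i], which is a lower bound and is attained at [s]. *)
Lemma potential_subgradient i x s t p : nearest (x + s *: unit i) p ->
  potential (x + s *: unit i) + p ord0 i * (t - s) <=
  potential (x + t *: unit i).
Proof.
have [j ij] := ord2_other i.
set xs := x + _; set xt := x + _ => np.
have h : depth xt ^+ 2 <= edist xt p ^+ 2.
  by rewrite ler_sqr ?nnegrE ?edist_ge0 ?depth_ge0// depth_le// np.1.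
move: h; rewrite /potential (depth_nearest np); move: (depth xt) => d.
rewrite !(edist_sqr _ _ ij) !(enorm_sqr _ ij).
rewrite !unit_coord !(unit_coord_neq _ _ ij); nra.
Qed.

Lemma derivable_potential i x s :
  derivable (depth : 'rV[R]_2 -> R^o) (x + s *: unit i) (unit i) ->
  derivable (fun t : R => potential (x + t *: unit i)) s 1.
Proof.
have [j ij] := ord2_other i.
move=> dd; pose f t := depth (x + t *: unit i).
have df : derivable f s 1.
  have E : (fun h : R => h^-1 *: (depth (h *: unit i + (x + s *: unit i)) -
        depth (x + s *: unit i))) =
      (fun h : R => h^-1 *: ((f \o shift s) (h *: 1) - f s)).
    apply/funext => h; rewrite /f /=.
    have -> : (h *: 1 : R) = h by exact: mulr1.
    have -> : h *: unit i + (x + s *: unit i) = x + (h + s) *: unit i.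
      by rewrite scalerDl addrCA.
    reflexivity.
  exact: (eq_ind _ (fun u : R -> R => cvg (u h @[h --> 0^'])) dd _ E).
have -> : (fun t : R => potential (x + t *: unit i)) =
    2^-1 *: ((cst (x ord0 i) + id) ^+ 2 + cst (x ord0 j ^+ 2) - f ^+ 2).
  apply/funext => t; rewrite /potential !fctE /f.
  rewrite (enorm_sqr _ ij) unit_coord (unit_coord_neq _ _ ij).
  by rewrite [RHS]mulrC.
have dx : derivable (cst (x ord0 i) + (id : R -> R)) s 1.
  by apply: derivableD; [exact: derivable_cst|exact: derivable_id].
apply: derivableZ; apply: derivableB; last exact: derivableX.
by apply: derivableD; [exact: derivableX|exact: derivable_cst].
Qed.

(** * Boxes over which the horizon is differentiable *)

Section SmoothBox.
Context (x0 : 'rV[R]_2) (r : R) (r_gt0 : 0 < r)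
  (box_interior : forall x, ball x0 r x -> F x < c)
  (box_derivable : forall x i, ball x0 r x ->
    derivable (depth : 'rV[R]_2 -> R^o) x (unit i)).

Local Notation lo x i := (x0 ord0 i - r - x ord0 i).
Local Notation hi x i := (x0 ord0 i + r - x ord0 i).

(** Balls of the max norm are squares, so the admissible [s] depend on one coordinate only. *)
Lemma box_line i x s : ball x0 r x ->
  (s \in `]lo x i, hi x i[) <->
  ball x0 r (x + s *: unit i).
Proof.
have [j ij] := ord2_other i.
move=> xr; rewrite in_itv /=; split.
  move=> /andP[s1 s2]; apply/(ball_coordP _ _ r_gt0) => k.
  have [->|->] := ord2_cases k ij.
    rewrite unit_coord ltr_norml; apply/andP; split; lra.
  by rewrite (unit_coord_neq _ _ ij); exact: (ball_coordP _ _ r_gt0).1.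
move=> /(ball_coordP _ _ r_gt0)/(_ i); rewrite unit_coord ltr_norml => /andP[? ?].
by apply/andP; split; lra.
Qed.

Lemma box_line0 i x : ball x0 r x ->
  0 \in `]lo x i, hi x i[.
Proof. by move=> xr; apply/box_line => //; rewrite scale0r addr0. Qed.

Lemma box_nearest_unique x p p' : ball x0 r x ->
  nearest x p -> nearest x p' -> p = p'.
Proof.
move=> xr np np'; apply/rowP => i.
have dpot t : t \in `]lo x i, hi x i[ ->
    derivable (fun t : R => potential (x + t *: unit i)) t 1.
  by move=> /(box_line _ _ xr) tr; apply: derivable_potential; exact: box_derivable.
have sub p1 : nearest x p1 -> forall t,
    t \in `]lo x i, hi x i[ ->
    potential (x + 0 *: unit i) + p1 ord0 i * (t - 0) <= potential (x + t *: unit i).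
  by move=> h t _; apply: potential_subgradient; rewrite scale0r addr0.
exact: (subgradient_unique dpot (box_line0 _ xr) (sub p np) (sub p' np')).
Qed.

(** This opposes the monotonicity of the subgradients of the convex potential; together they make
    the coordinate constant along the segment. *)
Lemma foot_line_coord_le i x s s' : ball x0 r x ->
  ball x0 r (x + s *: unit i) -> ball x0 r (x + s' *: unit i) -> s <= s' ->
  foot (x + s' *: unit i) ord0 i <= foot (x + s *: unit i) ord0 i.
Proof.
have [j ij] := ord2_other i.
move=> xr /(box_line _ _ xr) sr /(box_line _ _ xr) s'r ss'.
rewrite leNgt; apply/negP => gg.
pose g (t : R) : R := foot (x + t *: unit i) ord0 i.
have dpot t : t \in `]lo x i, hi x i[ ->
    derivable (fun t : R => potential (x + t *: unit i)) t 1.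
  by move=> /(box_line _ _ xr) tr; apply: derivable_potential; exact: box_derivable.
have sub (t u : R) : t \in `]lo x i, hi x i[ ->
    u \in `]lo x i, hi x i[ ->
    potential (x + t *: unit i) + g t * (u - t) <= potential (x + u *: unit i).
  by move=> _ _; apply: potential_subgradient; exact: footP.
have level (q : rat) : g s <= ratr q -> ratr q <= g s' ->
    exists2 p, F p = c & p ord0 i = ratr q /\ p ord0 j = x ord0 j.
  move=> gq qg; have [t tr gt] := subgradient_darboux dpot sub sr s'r ss' gq qg.
  have tb : F (x + t *: unit i) < c by apply: box_interior; exact/(box_line _ _ xr).
  have nt := footP (x + t *: unit i).
  exists (foot (x + t *: unit i)); first exact: (nearest_level (ltW tb) nt).
  split; first exact: gt.
  by rewrite (nearest_rational ij tb nt gt) unit_coord_neq.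
(* Here [e > 0] says that [p'] lies beyond [p] on a ray from [x], whence [F p' > c]. *)
have contra p p' : F p = c -> F p' = c -> p ord0 j = x ord0 j ->
    p' ord0 j = x ord0 j ->
    0 < (p' ord0 i - p ord0 i) / (p ord0 i - x ord0 i) -> False.
  set e := _ / _ => pc p'c pj p'j e0.
  have d0 : p ord0 i - x ord0 i != 0.
    by apply/eqP => h; move: e0; rewrite /e h invr0 mulr0 ltxx.
  have cp : c <= F p by rewrite pc.
  have := level_beyond (box_interior xr) cp e0.
  suff -> : p + e *: (p - x) = p' by rewrite p'c ltxx.
  apply: (row2_eq ij); rewrite !mxE; last by rewrite pj p'j; ring.
  by rewrite /e; field.
(* One of the halves cut off by [m] lies on a single side of [x ord0 i]; both rationals are taken
   there. *)
pose m := (g s + g s') / 2.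
have [xm|mx] := leP (x ord0 i) m.
  have [q1] : exists q : rat, ratr q \in `]m, (g s')[.
    by apply: rat_in_itvoo; rewrite /m /g; lra.
  rewrite in_itv /= => /andP[mq1 q1s].
  have [q2] := rat_in_itvoo q1s; rewrite in_itv /= => /andP[q12 q2s].
  have [| |p1 p1c [p1i p1j]] := level q1;
    [by rewrite /m /g in mq1 *; lra|exact: ltW|].
  have [| |p2 p2c [p2i p2j]] := level q2;
    [by rewrite /m /g in mq1 *; lra|exact: ltW|].
  apply: (contra p1 p2) => //; rewrite p1i p2i divr_gt0 ?subr_gt0//; lra.
have [q2] : exists q : rat, ratr q \in `](g s), m[.
  by apply: rat_in_itvoo; rewrite /m /g; lra.
rewrite in_itv /= => /andP[sq2 q2m].
have [q1] := rat_in_itvoo sq2; rewrite in_itv /= => /andP[sq1 q12].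
have [| |p1 p1c [p1i p1j]] := level q1;
  [exact: ltW|by rewrite /m /g in q2m *; lra|].
have [| |p2 p2c [p2i p2j]] := level q2;
  [exact: ltW|by rewrite /m /g in q2m *; lra|].
apply: (contra p2 p1) => //; rewrite p1i p2i nmulr_rgt0 ?invr_lt0; lra.
Qed.

Lemma foot_line_coord i x s : ball x0 r x -> ball x0 r (x + s *: unit i) ->
  foot (x + s *: unit i) ord0 i = foot x ord0 i.
Proof.
move=> xr sr; have x0r : ball x0 r (x + 0 *: unit i) by rewrite scale0r addr0.
wlog s0 : x s xr sr x0r / 0 <= s.
  move=> h; have [/(h x s)|s0] := leP 0 s; first exact.
  have E : x = x + s *: unit i + (- s) *: unit i.
    by rewrite -addrA -scalerDl subrr scale0r addr0.
  rewrite {2}E; apply/esym/h; rewrite -?E ?scale0r ?addr0// oppr_ge0; exact: ltW.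
apply/eqP; rewrite eq_le; apply/andP; split.
  by have := foot_line_coord_le xr x0r sr s0; rewrite scale0r addr0.
(* Adding the subgradient inequalities at the two end points gives the opposite inequality. *)
have := @potential_subgradient i x 0 s (foot x).
have := @potential_subgradient i x s 0 _ (footP (x + s *: unit i)).
rewrite scale0r addr0 => a /(_ (footP x)) b.
have [->|s1] := eqVneq s 0; first by rewrite scale0r addr0.
have {}s0 : 0 < s by rewrite lt_def s1.
rewrite -(ler_pM2r s0); lra.
Qed.

(** The two feet share the i-th coordinate, so moving along [unit i] changes both squared distances
    equally; hence [foot x] is also nearest to the moved point. *)
Lemma foot_line i x s : ball x0 r x -> ball x0 r (x + s *: unit i) ->
  foot (x + s *: unit i) = foot x.
Proof.
have [j ij] := ord2_other i.
move=> xr sr; have E := foot_line_coord xr sr.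
apply: (box_nearest_unique sr (footP _)).
have [cx hx] := footP x; have [cs hs] := footP (x + s *: unit i).
split => // y /hs; apply: le_trans.
have h : edist x (foot x) ^+ 2 <= edist x (foot (x + s *: unit i)) ^+ 2.
  by rewrite ler_sqr ?nnegrE ?edist_ge0// hx.
rewrite -ler_sqr ?nnegrE ?edist_ge0//; move: h.
rewrite !(edist_sqr _ _ ij) unit_coord (unit_coord_neq _ _ ij) E.
lra.
Qed.

Lemma foot_box x : ball x0 r x -> foot x = foot x0.
Proof.
move=> xr; pose j : 'I_2 := lift ord0 ord0.
have ij : (ord0 : 'I_2) != j by [].
have x0r : ball x0 r x0 by exact: ballxx.
(* The corner of an axis-parallel path from [x0] to [x] inside the square. *)
pose z := x0 + (x ord0 ord0 - x0 ord0 ord0) *: unit ord0.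
have zr : ball x0 r z.
  apply/(ball_coordP _ _ r_gt0) => k; have [->|->] := ord2_cases k ij.
    by rewrite unit_coord [X in _ - X]addrC subrK; exact: (ball_coordP _ _ r_gt0).1.
  by rewrite (unit_coord_neq _ _ ij) subrr normr0.
have xz : x = z + (x ord0 j - x0 ord0 j) *: unit j.
  apply: (row2_eq ij); first by rewrite unit_coord_neq// unit_coord addrC subrK.
  by rewrite unit_coord (unit_coord_neq _ _ ij) addrC subrK.
by rewrite xz foot_line -?xz// foot_line.
Qed.

(* If all points of the box have the same foot point [p], the discs about
   [x0 + e w] and [x0 - e w], with [w] orthogonal to [p - x0], have radius
   greater than [|p - x0|], and their convex hull contains points beyond [p]. *)
Lemma no_smooth_box : False.
Proof.
pose i : 'I_2 := ord0; pose j : 'I_2 := lift ord0 ord0.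
have ij : i != j by [].
have x0r : ball x0 r x0 by exact: ballxx.
have x0c := box_interior x0r.
pose p := foot x0; pose v := p - x0.
have pc : F p = c := nearest_level (ltW x0c) (footP x0).
pose w : 'rV[R]_2 := \row_k (if k == i then - v ord0 j else v ord0 i).
have wi : w ord0 i = - v ord0 j by rewrite mxE eqxx.
have wj : w ord0 j = v ord0 i by rewrite mxE eq_sym (negPf ij).
have nw : enorm w ^+ 2 = enorm v ^+ 2.
  by rewrite !(enorm_sqr _ ij) wi wj; ring.
pose e := Num.min 1 (r / (1 + enorm v)).
have n0 := enorm_ge0 v.
have e0 : 0 < e by rewrite lt_min ltr01 divr_gt0// ltr_pwDl.
have e1 : e <= 1 by rewrite ge_min lexx.
have er : e * (1 + enorm v) <= r.
  by rewrite -ler_pdivlMr ?ltr_pwDl// ge_min lexx orbT.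
have nwv : enorm w = enorm v.
  by apply/eqP; rewrite -(@eqrXn2 _ 2) ?enorm_ge0// nw.
have inb d : d ^+ 2 = 1 -> ball x0 r (x0 + (d * e) *: w).
  move=> d1; apply/(ball_coordP _ _ r_gt0) => k.
  have -> : x0 ord0 k - (x0 + (d * e) *: w) ord0 k = - ((d * e) * w ord0 k).
    by rewrite !mxE; ring.
  have nd : `|d| = 1.
    by apply/eqP; rewrite -(@eqrXn2 _ 2)// real_normK ?num_real// d1 expr1n.
  rewrite normrN !normrM nd mul1r (gtr0_norm e0) (lt_le_trans _ er)//.
  by rewrite ltr_pM2l// (le_lt_trans (coord_le_enorm _ _))// nwv ltrDr.
(* Small enough for (1 + h)^2 <= 1 + e^2, the squared ratio of the new radius to |v|. *)
pose h := e ^+ 2 / 4.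
have h0 : 0 < h by rewrite divr_gt0// exprn_gt0.
have hE : h * 4 = e ^+ 2 by rewrite divfK.
have h1 : h <= 1.
  have : e ^+ 2 <= 1 by rewrite expr_le1// ltW.
  lra.
have inK d : d ^+ 2 = 1 -> F (x0 + (d * e) *: w + (1 + h) *: v) <= c.
  move=> d1; have br := inb d d1; have bc := box_interior br.
  apply: (depth_closed_ball (ltW bc)); rewrite /depth foot_box// -/p.
  rewrite /edist opprD addNKr enormN enormZ ger0_norm; last lra.
  rewrite -ler_sqr ?nnegrE ?mulr_ge0 ?enorm_ge0//; last lra.
  have -> : x0 + (d * e) *: w - p = (d * e) *: w - v.
    by apply/rowP => k; rewrite !mxE; ring.
  have -> : enorm ((d * e) *: w - v) ^+ 2 = (1 + d ^+ 2 * e ^+ 2) * enorm v ^+ 2.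
    rewrite !(enorm_sqr _ ij) !mxE; have a := wi; have b := wj.
    by rewrite !mxE in a b; rewrite a b; ring.
  rewrite d1 exprMn ler_wpM2r ?sqr_ge0//; nra.
have k1 := inK 1 (expr1n _ 2).
have k2 := inK (- 1) (etrans (sqrrN 1) (expr1n _ 2)).
have cp : c <= F p by rewrite pc.
have := level_beyond x0c cp h0; apply/negP; rewrite -leNgt.
have hf0 : 0 <= (2^-1 : R) by [].
have hf1 : (2^-1 : R) <= 1 by lra.
(* The midpoint of the two disc points is [p + h *: v], beyond [p] as seen from [x0]. *)
have := F_convex (x0 + (1 * e) *: w + (1 + h) *: v)
  (x0 + (- 1 * e) *: w + (1 + h) *: v) hf0 hf1.
have -> : 2^-1 *: (x0 + (1 * e) *: w + (1 + h) *: v) +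
  (1 - 2^-1) *: (x0 + (- 1 * e) *: w + (1 + h) *: v) = p + h *: (p - x0).
  by apply/rowP => k; rewrite !mxE; field.
lra.
Qed.

End SmoothBox.

Lemma sublevel_nondiff_dense : Hplus K `<=` closure (nondiff_set K).
Proof.
move=> [x t] /Hplus_sublevel[/= xc ->] W Wx; apply: contrapT => H.
have cF : continuous F := lipschitz_continuous F_lipschitz.
have cd : continuous depth := lipschitz_continuous depth_lipschitz.
have cg y : (z, depth z) @[z --> y] --> (y, depth y).
  exact: (@cvg_pair _ _ _ (nbhs y) (nbhs y) (nbhs (depth y)) _ _ _ id depth
    cvg_id (cd y)).
have [r /= r0 hr] := (nbhs_ballP _ _).1 (cg x _ Wx).
(* As [x] may satisfy [F x = c], it is first moved into [F < c], so little that the graph stays in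
   [W]. *)
pose v := z0 - x; pose e := Num.min 1 (r / (1 + enorm v)).
have n0 := enorm_ge0 v.
have e0 : 0 < e by rewrite lt_min ltr01 divr_gt0// ltr_pwDl.
have e1 : e <= 1 by rewrite ge_min lexx.
have er : e * (1 + enorm v) <= r.
  by rewrite -ler_pdivlMr ?ltr_pwDl// ge_min lexx orbT.
pose x1 := x + e *: v.
have x1c : F x1 < c := sublevel_toward xc e0 e1.
have x1r : ball x r x1.
  apply/(ball_coordP _ _ r0) => k.
  have -> : x ord0 k - x1 ord0 k = - (e * v ord0 k) by rewrite !mxE; ring.
  rewrite normrN normrM (gtr0_norm e0) (lt_le_trans _ er)// ltr_pM2l//.
  by rewrite (le_lt_trans (coord_le_enorm _ _))// ltrDr.
have near_lt y : F y < c -> \forall z \near y, F z < c.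
  exact: (@cvgr_lt _ _ (nbhs y) _ F (F y) (cF y)).
have : nbhs x1 (ball x r `&` [set y | F y < c]).
  by apply: filterI; [exact: (open_nbhs_nbhs (conj (ball_open x r) x1r))|exact: near_lt].
move=> /nbhs_ballP[s /= s0 hs].
apply: (@no_smooth_box x1 s s0) => [y /hs[]//|y i ys].
have [yr yc] := hs _ ys.
have HHy : Hplus K (y, depth y) by apply/Hplus_sublevel; split => //; exact: ltW.
have [V Vy [f df hf]] : diff_point (Hplus K) (y, depth y).
  apply: contrapT => ny; apply: H; exists (y, depth y); split => //.
  exact: hr.
(* Near [y] the horizon is the graph of [depth], so [f] and [depth] agree there. *)
apply: (@near_eq_derivable _ _ _ f) (diff_derivable df).
near=> z; apply/esym.
have zc : F z < c by near: z; exact: near_lt.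
have Vz : V (z, depth z) by near: z; exact: (cg y _ Vy).
by apply/(hf _ Vz)/Hplus_sublevel; split => //; exact: ltW.
Unshelve. all: by end_near.
Qed.

End SublevelSet.

(** * The approximating convex body *)

Section DistanceToConvex.
Context {R : realType} (K : set 'rV[R]_2) (K0 : K !=set0).
Implicit Types (x y a b : 'rV[R]_2).

Definition dist_to x : R := inf [set edist a x | a in K].

Lemma dist_to_le a x : K a -> dist_to x <= edist a x.
Proof.
move=> Ka; apply: ge_inf; last by exists a.
by exists 0 => _ [b _ <-]; exact: edist_ge0.
Qed.

Lemma le_dist_to x d : (forall a, K a -> d <= edist a x) -> d <= dist_to x.
Proof.
move=> h; apply: lb_le_inf; last by move=> _ [a Ka <-]; exact: h.
by have [a Ka] := K0; exists (edist a x), a.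
Qed.

Lemma dist_to_ge0 x : 0 <= dist_to x.
Proof. by apply: le_dist_to => a _; exact: edist_ge0. Qed.

Lemma dist_to_in x : K x -> dist_to x = 0.
Proof.
move=> Kx; apply/eqP; rewrite eq_le dist_to_ge0 andbT.
by rewrite (le_trans (dist_to_le x Kx))// edistxx.
Qed.

Lemma dist_to_approx x e : 0 < e -> exists2 a, K a & edist a x < dist_to x + e.
Proof.
move=> e0; suff [_ [a Ka <-] h] : exists2 d, [set edist a x | a in K] d &
    d < dist_to x + e by exists a.
apply: inf_adherent => //; split.
  by have [a Ka] := K0; exists (edist a x), a.
by exists 0 => _ [b _ <-]; exact: edist_ge0.
Qed.

Lemma dist_to_lipschitz x y : dist_to x <= dist_to y + edist x y.
Proof.
rewrite -lerBlDr; apply: le_dist_to => a Ka; rewrite lerBlDr.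
by rewrite [edist x y]edistC (le_trans (dist_to_le x Ka))// edist_triangle.
Qed.

(** The convex combination of almost nearest points of [K] to [x] and [y] lies in [K]. *)
Lemma dist_to_convex l x y :
  convex_set (K : set (convex_lmodType 'rV[R]_2)) -> 0 <= l -> l <= 1 ->
  dist_to (l *: x + (1 - l) *: y) <= l * dist_to x + (1 - l) * dist_to y.
Proof.
move=> cK l0 l1; apply/ler_addgt0Pr => e e0.
have [a Ka ha] := dist_to_approx x e0; have [b Kb hb] := dist_to_approx y e0.
have Kab : K (l *: a + (1 - l) *: b).
  by have := cK a b (Itv01 l0 l1); rewrite !inE => /(_ Ka Kb).
apply: le_trans (dist_to_le _ Kab) _.
have -> : edist (l *: a + (1 - l) *: b) (l *: x + (1 - l) *: y) =
    enorm (l *: (a - x) + (1 - l) *: (b - y)).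
  by congr enorm; apply/rowP => k; rewrite !mxE; ring.
apply: le_trans (enormD _ _) _; rewrite !enormZ ger0_norm// ger0_norm ?subr_ge0//.
rewrite -/(edist a x) -/(edist b y); nra.
Qed.

End DistanceToConvex.

(** * The distance to [K] with added corners *)

Section KinkedDistance.
Context {R : realType} (K : set 'rV[R]_2) (d : R) (K0 : K !=set0) (d0 : 0 < d)
  (convK : convex_set (K : set (convex_lmodType 'rV[R]_2))).
Implicit Types (x y p u : 'rV[R]_2) (i : 'I_2) (l : R).

Definition kinked_dist x : R :=
  dist_to K x + d * (kink (x ord0 ord0) + kink (x ord0 (lift ord0 ord0))).

Lemma kinked_dist_lipschitz x y :
  kinked_dist x <= kinked_dist y + (1 + 4 * d) * edist x y.
Proof.
have h k : kink (x ord0 k) <= kink (y ord0 k) + 2 * edist x y.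
  rewrite (le_trans (kink_lipschitz _ (y ord0 k)))// lerD2l ler_pM2l//.
  by have := coord_le_enorm k (x - y); rewrite !mxE.
have := ler_wpM2l (ltW d0) (h ord0).
have := ler_wpM2l (ltW d0) (h (lift ord0 ord0)).
by have := dist_to_lipschitz K0 x y; rewrite /kinked_dist; lra.
Qed.

Lemma kinked_dist_convex l x y : 0 <= l -> l <= 1 ->
  kinked_dist (l *: x + (1 - l) *: y) <=
  l * kinked_dist x + (1 - l) * kinked_dist y.
Proof.
move=> l0 l1; have := dist_to_convex K0 x y convK l0 l1.
have h k := kink_convex (x ord0 k) (y ord0 k) l0 l1.
have := ler_wpM2l (ltW d0) (h ord0).
have := ler_wpM2l (ltW d0) (h (lift ord0 ord0)).
by rewrite /kinked_dist !mxE; lra.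
Qed.

(** The kink in the i-th coordinate supplies the corner; the distance and the other kink are
    midpoint convex. *)
Lemma kinked_dist_corner (q : rat) i : exists2 a : R, 0 < a &
  forall p u, p ord0 i = ratr q ->
    2 * kinked_dist p + 2 * a * `|u ord0 i| <=
    kinked_dist (p + u) + kinked_dist (p - u).
Proof.
have [a a0 ha] := @kink_corner R q; exists (d * a); first exact: mulr_gt0.
move=> p u piq; have := ler_wpM2l (ltW d0) (ha (u ord0 i)).
have half : 2^-1 <= (1 : R) by lra.
have half0 : 0 <= (2^-1 : R) by [].
have := dist_to_convex K0 (p + u) (p - u) convK half0 half.
have -> : 2^-1 *: (p + u) + (1 - 2^-1) *: (p - u) = p.
  by apply/rowP => k; rewrite !mxE; field.
have mid k : 2 * kink (p ord0 k) <=
    kink (p ord0 k + u ord0 k) + kink (p ord0 k - u ord0 k).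
  have := kink_convex (p ord0 k + u ord0 k) (p ord0 k - u ord0 k) half0 half.
  have -> : 2^-1 * (p ord0 k + u ord0 k) + (1 - 2^-1) * (p ord0 k - u ord0 k) =
    p ord0 k by field.
  lra.
have ij : (ord0 : 'I_2) != lift ord0 ord0 by [].
rewrite /kinked_dist !mxE -piq.
have m0 := ler_wpM2l (ltW d0) (mid ord0).
have m1 := ler_wpM2l (ltW d0) (mid (lift ord0 ord0)).
by have [->|->] := ord2_cases i ij; lra.
Qed.

Lemma dist_to_le_kinked x : dist_to K x <= kinked_dist x.
Proof. by rewrite lerDl mulr_ge0 ?(ltW d0)// addr_ge0// kink_ge0. Qed.

End KinkedDistance.


(** * Choice of the constants and the approximation *)

Unset Implicit Arguments.
Set Strict Implicit.

Theorem theorem3 (R : realType) (K : set 'rV[R]_2) (eps : R) :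
  convex_body K -> 0 < eps ->
  exists K' : set 'rV[R]_2,
    [/\ convex_body K', hausdorff_dist K K' < eps &
        Hplus K' `<=` closure (nondiff_set K')].
Proof.
move=> [compK convK [k0 intk0]] eps0.
have K0 : K !=set0 by exists k0; exact: interior_subset.
have [M0 [_ hM0]] := compact_bounded compK.
have [M M_ge0 hM] : exists2 M, 0 <= M & forall y, K y -> enorm y <= M.
  exists (2 * (`|M0| + 1)) => [|y Ky]; first by rewrite mulr_ge0.
  rewrite (le_trans (enorm_le_norm _))// ler_pM2l//; apply: hM0 => //.
  by rewrite (le_lt_trans (ler_norm _))// ltrDl.
(* Since [dist_to K <= F], the set [F <= c] stays within [c] of [K]; halving [eps] makes the final
   bound strict. *)
pose c := eps / 2; have c0 : 0 < c by rewrite divr_gt0.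
(* Each kink is at most 2(1 + M) on [K], so that [F <= c / 2] there. *)
pose d := c / (8 * (1 + M)).
have M1 : 0 < 8 * (1 + M) by rewrite mulr_gt0// ltr_pwDl.
have d0 : 0 < d by rewrite divr_gt0.
have dE : d * (8 * (1 + M)) = c by rewrite divfK// gt_eqF.
pose F := kinked_dist K d.
have F_lip : forall x y, F x <= F y + (1 + 4 * d) * edist x y.
  by move=> x y; exact: kinked_dist_lipschitz.
have F_conv : forall l x y, 0 <= l -> l <= 1 ->
    F (l *: x + (1 - l) *: y) <= l * F x + (1 - l) * F y.
  by move=> l x y; exact: kinked_dist_convex.
have F_corner := kinked_dist_corner K0 d0 convK.
have Fge : forall x, dist_to K x <= F x by exact: dist_to_le_kinked.
have FK x : K x -> F x < c.
  move=> Kx; rewrite /F /kinked_dist (dist_to_in K0 Kx) add0r.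
  have h k : kink (x ord0 k) <= 2 * (1 + M).
    rewrite (le_trans (kink_bound _))// ler_pM2l// lerD2l.
    exact: (le_trans (coord_le_enorm _ _) (hM _ Kx)).
  have := h ord0; have := h (lift ord0 ord0); nra.
(* The coordinates on [K] are at most [M], so [y0] has distance at least [c] from [K]. *)
pose y0 : 'rV[R]_2 := const_mx (M + c).
have F_y0 : c <= F y0.
  apply: le_trans (Fge _); apply: (le_dist_to K0) => a Ka.
  have := coord_le_enorm ord0 (a - y0); have := coord_le_enorm ord0 a.
  rewrite !mxE -/(edist a y0) => h1 h2; have := hM _ Ka.
  have := ler_norm (a ord0 ord0); have := ler_norm (- (a ord0 ord0 - (M + c))).
  rewrite normrN; lra.
have Kk0 : K k0 := interior_subset intk0.
have L0 : 0 <= 1 + 4 * d by lra.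
have cF : continuous F := lipschitz_continuous F_lip.
have KK' : K `<=` [set x | F x <= c] by move=> x /FK/ltW.
exists [set x | F x <= c]; split; last first.
- exact: (sublevel_nondiff_dense L0 F_lip F_conv (FK _ Kk0) F_y0 F_corner).
- apply: (@le_lt_trans _ _ c); last by rewrite /c; lra.
  rewrite /hausdorff_dist ge_max; apply/andP; split.
    apply: ge_sup; first by exists (inf [set edist k0 b | b in [set x | F x <= c]]), k0.
    move=> _ [a Ka <-]; apply: (@le_trans _ _ (edist a a)); last by rewrite edistxx ltW.
    apply: ge_inf; last by exists a => //; exact: KK'.
    by exists 0 => _ [b _ <-]; exact: edist_ge0.
  apply: ge_sup; first by exists (dist_to K k0), k0 => //; exact: KK'.
  by move=> _ [b bc <-]; exact: le_trans (Fge b) bc.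
split.
- apply: bounded_closed_compact; last exact: closed_sublevel.
  (* The summand 1 is the slack of the almost nearest point [a] below. *)
  exists (M + c + 1); split; first exact: num_real.
  move=> N hN x /= xc; rewrite (le_trans _ (ltW hN))//.
  have [a Ka ha] := dist_to_approx K0 x ltr01.
  have -> : x = a - (a - x) by rewrite subKr.
  have := ler_normB a (a - x); have := norm_le_enorm a; have := norm_le_enorm (a - x).
  have := hM _ Ka; have := Fge x; rewrite -/(edist a x); lra.
- move=> x y l; rewrite !inE => xc yc.
  suff : F (l%:num *: x + (1 - l%:num) *: y) <= c by [].
  have l0 : 0 <= l%:num by []; have l1 : l%:num <= 1 by [].
  apply: le_trans (F_conv _ x y l0 l1) _.
  have h1 : l%:num * F x <= l%:num * c by rewrite ler_wpM2l.
  have h2 : (1 - l%:num) * F y <= (1 - l%:num) * c by rewrite ler_wpM2l// subr_ge0.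
  lra.
- by exists k0; exact: (interiorS KK').
Qed.
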